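(* Let $1\le p\le\infty$, let $X_1,\dots,X_n,Y$ be Banach spaces and let $T:X_1\times\dots\times X_n\to Y$ be a bounded multilinear operator. Then $T$ is $\pi$-$(p,\infty)$-dominated if and only if $T$ is Lipschitz $p$-summing. In this case $\pi_p^{Lip}(T)=D_{p,\infty}^\pi(T)$.
   Context: All Banach spaces are over the same field $\mathbb K\in\{\mathbb R,\mathbb C\}$; $s^*$ is the conjugate exponent of $s\in[1,\infty]$; $B_X$ is the closed unit ball; $\mathcal L(X_1,\dots,X_n)$ is the Banach space of bounded multilinear forms with the sup norm. For finite sequences, $\|(x_i^1\otimes\dots\otimes x_i^n-z_i^1\otimes\dots\otimes z_i^n)_{i=1}^m\|_p^{w,\pi}=\sup_{\varphi\in B_{\mathcal L(X_1,\dots,X_n)}}\big(\sum_i|\varphi(x_i^1,\dots,x_i^n)-\varphi(z_i^1,\dots,z_i^n)|^p\big)^{1/p}$ and $\|(y_i^* )_{i=1}^m\|_q^w=\sup_{y^{**}\in B_{Y^{**}}}\big(\sum_i|y^{**}(y_i^* )|^q\big)^{1/q}$ (maxima over $i$ if the exponent is $\infty$; so $\|(y_i^* )_{i=1}^m\|_\infty^w=\max_i\|y_i^*\|$). For $1\le p,q\le\infty$ with $\frac1p+\frac1q\le1$ and $r\in[1,\infty]$ determined by $1=\frac1r+\frac1p+\frac1q$, $T$ is $\pi$-$(p,q)$-dominated if there is $C>0$ with $$\|(\langle y_i^*,T(x_i^1,\dots,x_i^n)-T(z_i^1,\dots,z_i^n)\rangle)_{i=1}^m\|_{r^*}\le C\,\|(x_i^1\otimes\dots\otimes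 x_i^n-z_i^1\otimes\dots\otimes z_i^n)_{i=1}^m\|_p^{w,\pi}\,\|(y_i^* )_{i=1}^m\|_q^w$$ for all finite sequences $(x_i^1,\dots,x_i^n)_{i=1}^m,(z_i^1,\dots,z_i^n)_{i=1}^m$ in $X_1\times\dots\times X_n$ and $(y_i^* )_{i=1}^m$ in $Y^*$; $D_{p,q}^\pi(T)$ is the infimum of such $C$. (For $q=\infty$, $r^*=p$.) $T$ is Lipschitz $p$-summing if there is $C>0$ with $\big(\sum_{i=1}^m\|T(x_i)-T(z_i)\|^p\big)^{1/p}\le C\,\|(x_i^1\otimes\dots\otimes x_i^n-z_i^1\otimes\dots\otimes z_i^n)_{i=1}^m\|_p^{w,\pi}$ for all finite sequences $x_i=(x_i^1,\dots,x_i^n)$, $z_i=(z_i^1,\dots,z_i^n)$ in $X_1\times\dots\times X_n$ (maximum over $i$ on the left if $p=\infty$); $\pi_p^{Lip}(T)$ is the least such $C$. *)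

(* Defs.v *)
From HB Require Import structures.
From mathcomp Require Import all_boot all_order all_algebra.
From mathcomp Require Import complex.
From mathcomp Require Import all_classical all_reals all_analysis.
Set Implicit Arguments.
Unset Strict Implicit.
Unset Printing Implicit Defensive.
Import Order.TTheory GRing.Theory Num.Theory.
Import numFieldNormedType.Exports.
Local Open Scope classical_set_scope.
Local Open Scope ring_scope.

Variant base_field := RealField | ComplexField.

Definition scalar_field (R : realType) (b : base_field) : numFieldType :=
  match b with RealField => R | ComplexField => R[i] end.

Definition real_part (R : realType) (b : base_field) : scalar_field R b -> R :=
  match b with RealField => id | ComplexField => @complex.Re R end.

(* In a [normedModType K] the norm is [K]-valued; over [R[i]] its values are
   nonnegative reals embedded in [R[i]], so [real_part] loses nothing. *)
Definition rnorm (R : realType) (b : base_field)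
    (V : normedModType (scalar_field R b)) (v : V) : R :=
  real_part `|v|.

Section dual_space.
Context {K : numFieldType} (Y : normedModType K).

Definition bounded_form : {pred Y -> K^o} :=
  [pred f : Y -> K^o |
     `[< linear f /\ exists M : K, forall y, `|f y| <= M * `|y| >]].

Lemma bounded_form_submod_closed : submod_closed bounded_form.
Proof.
split=> [|a f g /asboolP[fl [M fM]] /asboolP[gl [N gN]]]; apply/asboolP; split.
- by move=> a u v; rewrite scaler0 addr0.
- by exists 0 => y; rewrite mul0r normr0.
- move=> c u v; rewrite !fctE fl gl !scalerDr addrACA !scalerA.
  by rewrite [c * a]mulrC.
- exists (`|a| * M + N) => y; rewrite !fctE (le_trans (ler_normD _ _))//.
  rewrite mulrDl lerD ?gN//.
  by rewrite normrZ -mulrA ler_wpM2l ?fM ?normr_ge0.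
Qed.

HB.instance Definition _ :=
  GRing.isSubmodClosed.Build K (Y -> K^o) bounded_form
    bounded_form_submod_closed.

Record dual := Dual { dual_val :> Y -> K^o; _ : dual_val \in bounded_form }.

HB.instance Definition _ := [isSub for dual_val].
HB.instance Definition _ := [Choice of dual by <:].
HB.instance Definition _ := [SubChoice_isSubLmodule of dual by <:].

End dual_space.

Section norms.
Context {R : realType} {b : base_field}.
Local Notation K := (scalar_field R b).

Definition dual_norm (Y : normedModType K) (f : dual Y) : \bar R :=
  ereal_sup [set (rnorm (f y))%:E | y in [set y : Y | rnorm y <= 1]].

(* No boundedness is required of [psi]: the bound on its norm entails it. *)
Definition bidual_ball (Y : normedModType K) : set (dual Y -> K^o) :=
  [set psi | linear psi /\
     (ereal_sup [set (rnorm (psi f))%:E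
                | f in [set f : dual Y | (dual_norm f <= 1)%E]] <= 1)%E].

Definition multilinear n (X : 'I_n -> normedModType K) (V : normedModType K)
    (f : (forall j, X j) -> V) : Prop :=
  forall (j : 'I_n) (x : forall j, X j), linear (fun u : X j => f (dfwith x j u)).

Definition bounded_multilinear n (X : 'I_n -> normedModType K)
    (V : normedModType K) (f : (forall j, X j) -> V) : Prop :=
  multilinear f /\
  exists M : R, forall x, rnorm (f x) <= M * \prod_(j < n) rnorm (x j).

Definition sup_norm n (X : 'I_n -> normedModType K) (V : normedModType K)
    (f : (forall j, X j) -> V) : \bar R :=
  ereal_sup [set (rnorm (f x))%:E
            | x in [set x : forall j, X j | forall j, rnorm (x j) <= 1]].

Definition forms_ball n (X : 'I_n -> normedModType K) :
    set ((forall j, X j) -> K^o) :=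
  [set phi | bounded_multilinear phi /\ (sup_norm phi <= 1)%E].

(* Only used for [1 <= p <= +oo]. *)
Definition lp_norm (p : \bar R) m (a : 'I_m -> R) : R :=
  match p with
  | r%:E => (\sum_(i < m) `|a i| `^ r) `^ r^-1
  | _ => \big[Num.max/0]_(i < m) `|a i|
  end.

Definition weak_pi_norm (p : \bar R) n (X : 'I_n -> normedModType K) m
    (x z : 'I_m -> forall j, X j) : \bar R :=
  ereal_sup [set (lp_norm p (fun i => rnorm (phi (x i) - phi (z i))))%:E
            | phi in @forms_ball n X].

Definition weak_norm (q : \bar R) (Y : normedModType K) m
    (y : 'I_m -> dual Y) : \bar R :=
  ereal_sup [set (lp_norm q (fun i => rnorm (psi (y i))))%:E
            | psi in @bidual_ball Y].

(* The $r$ with $1 = 1/r + 1/p + 1/q$; in [\bar R], [0^-1 = +oo] and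
   [+oo^-1 = 0]. *)
Definition third_exponent (p q : \bar R) : \bar R :=
  ((1 - p^-1 - q^-1)^-1)%E.

Section operators.
Context {n : nat} {X : 'I_n -> normedModType K} {Y : normedModType K}.
Implicit Types T : (forall j, X j) -> Y.

Definition pi_dominated_with (p q : \bar R) T (C : R) : Prop :=
  forall m (x z : 'I_m -> forall j, X j) (y : 'I_m -> dual Y),
    ((lp_norm (hoelder_conjugate (third_exponent p q))
        (fun i => rnorm (y i (T (x i) - T (z i)))))%:E
     <= C%:E * weak_pi_norm p x z * weak_norm q y)%E.

Definition pi_dominated (p q : \bar R) T : Prop :=
  exists2 C : R, 0 < C & pi_dominated_with p q T C.

Definition pi_dominated_norm (p q : \bar R) T : R :=
  inf [set C : R | 0 < C /\ pi_dominated_with p q T C].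

Definition lip_summing_with (p : \bar R) T (C : R) : Prop :=
  forall m (x z : 'I_m -> forall j, X j),
    ((lp_norm p (fun i => rnorm (T (x i) - T (z i))))%:E
     <= C%:E * weak_pi_norm p x z)%E.

Definition lip_summing (p : \bar R) T : Prop :=
  exists2 C : R, 0 < C & lip_summing_with p T C.

(* An infimum, since for [T = 0] there is no least [C > 0]. *)
Definition lip_summing_norm (p : \bar R) T : R :=
  inf [set C : R | 0 < C /\ lip_summing_with p T C].

End operators.
End norms.

(* Main.v *)
Require Import Defs.
From HB Require Import structures.
From mathcomp Require Import all_boot all_order all_algebra.
From mathcomp Require Import complex ring.
From mathcomp Require Import all_classical all_reals all_analysis.
Import Order.TTheory GRing.Theory Num.Theory.
Import numFieldNormedType.Exports.
Local Open Scope classical_set_scope.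
Local Open Scope ring_scope.

(* For a fixed C > 0 the two inequalities are equivalent.  The Lipschitz one
   implies the dominated one because |y'_i(v)| is at most ||v|| times the weak
   norm of the functionals y'_i, as evaluation at a point of B_Y lies in the ball
   of the bidual.  Conversely, apply the dominated one to functionals y'_i of
   norm at most 1 that norm T(x_i) - T(z_i).  These come from the Hahn-Banach
   theorem, obtained by taking a minimal element among the sublinear functionals
   below the norm. *)

(** * The Hahn-Banach theorem for sublinear functionals *)

Section hahn_banach.
Context {R : realType} {K : nzRingType} (iota : {rmorphism R -> K})
        {V : lmodType K}.
Implicit Types (q : V -> R) (x y : V) (t : R).

(** Homogeneity refers only to reals, embedded by [iota], so that a complex space is treated as a
    real one. The inequality becomes an equality by using it for [t^-1] as well. *)
Definition sublinear q : Prop :=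
  (forall x y, q (x + y) <= q x + q y) /\
  (forall t x, 0 < t -> q (iota t *: x) <= t * q x).

(** Homogeneity at [t = 1/2] gives [q 0 <= q 0 / 2], and subadditivity gives [q 0 <= q 0 + q 0]. *)
Lemma sublinear0 q : sublinear q -> q 0 = 0.
Proof.
move=> [qD qZ]; apply/eqP; rewrite eq_le; apply/andP; split.
  have := qZ 2^-1 0; rewrite scaler0 invr_gt0 ltr0n => /(_ isT).
  rewrite -subr_ge0 -{2}[q 0]mul1r -mulrBl.
  rewrite nmulr_rge0// subr_lt0 invf_lt1 ?ltr0n//.
  by rewrite ltr1n.
by have := qD 0 0; rewrite addr0 lerDl.
Qed.

Lemma sublinear_geN q x : sublinear q -> - q (- x) <= q x.
Proof.
move=> qs; rewrite lerNl -subr_ge0 opprK addrC -(sublinear0 q qs) -(subrr x).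
exact: qs.1.
Qed.

Lemma sublinearZ q t x : sublinear q -> 0 <= t -> q (iota t *: x) = t * q x.
Proof.
move=> qs; rewrite le_eqVlt => /predU1P[<-|t0].
  by rewrite rmorph0 scale0r mul0r sublinear0.
apply/eqP; rewrite eq_le qs.2//=.
rewrite -ler_pdivlMl//.
have {1}-> : x = iota t^-1 *: (iota t *: x).
  by rewrite scalerA -rmorphM mulVf ?gt_eqF// rmorph1 scale1r.
by apply: qs.2; rewrite invr_gt0.
Qed.

Definition pointwise_inf (F : set (V -> R)) : V -> R :=
  fun x => inf [set f x | f in F].

Lemma pointwise_inf_le (F : set (V -> R)) f x :
  (forall x, has_lbound [set f x | f in F]) -> F f -> pointwise_inf F x <= f x.
Proof. by move=> Fb Ff; apply: ge_inf => //; exists f. Qed.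

(** The last two hypotheses ask only for some member of [F] that does well enough, which covers both
    the family in [flatten_along] and the chains in Zorn's lemma. *)
Lemma sublinear_inf (F : set (V -> R)) :
    F !=set0 -> (forall x, has_lbound [set f x | f in F]) ->
    (forall f g x y, F f -> F g -> exists2 h, F h & h (x + y) <= f x + g y) ->
    (forall f t x, F f -> 0 < t -> exists2 h, F h & h (iota t *: x) <= t * f x) ->
  sublinear (pointwise_inf F).
Proof.
move=> [f0 Ff0] Fb FD FZ.
have ne x : [set f x | f in F] !=set0 by exists (f0 x), f0.
split=> [x y|t x t0].
  rewrite -lerBlDr; apply: lb_le_inf => // _ [f Ff <-].
  rewrite lerBlDr -lerBlDl; apply: lb_le_inf => // _ [g Fg <-].
  rewrite lerBlDl; have [h Fh hfg] := FD f g x y Ff Fg.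
  exact: le_trans (pointwise_inf_le F h _ Fb Fh) hfg.
rewrite -ler_pdivrMl//; apply: lb_le_inf => // _ [f Ff <-].
rewrite ler_pdivrMl//; have [h Fh hf] := FZ f t x Ff t0.
exact: le_trans (pointwise_inf_le F h _ Fb Fh) hf.
Qed.

(* Lowers [q] just enough to be linear in the direction [y]; a minimal
   sublinear functional is therefore linear. *)
Definition flatten_along q y : V -> R :=
  pointwise_inf [set f | exists2 t, 0 <= t &
    f = fun x => q (x + iota t *: y) - t * q y].

Lemma flatten_along_lbound q y x : sublinear q ->
  has_lbound [set f x | f in
    [set f | exists2 t, 0 <= t & f = fun x => q (x + iota t *: y) - t * q y]].
Proof.
(* The bound comes from [t * q y = q (iota t *: y) <= q (- x) + q (x + iota t *: y)]. *)
move=> qs; exists (- q (- x)) => _ [_ [t t0 ->] <-].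
rewrite lerBrDr addrC lerBlDr -sublinearZ//.
by rewrite -{1}[_ *: y](addKr x) (addrC (- x)) qs.1.
Qed.

Lemma flatten_along_le q y x t : sublinear q -> 0 <= t ->
  flatten_along q y x <= q (x + iota t *: y) - t * q y.
Proof.
move=> qs t0; apply: (pointwise_inf_le _ (fun x => q (x + iota t *: y) - t * q y)).
  by move=> z; exact: flatten_along_lbound.
by exists t.
Qed.

Lemma sublinear_flatten_along q y : sublinear q -> sublinear (flatten_along q y).
Proof.
move=> qs; apply: sublinear_inf.
- by exists (fun x => q (x + iota 0 *: y) - 0 * q y), 0.
- by move=> x; exact: flatten_along_lbound.
- move=> _ _ x z [t t0 ->] [s s0 ->].
  exists (fun x => q (x + iota (t + s) *: y) - (t + s) * q y).
    by exists (t + s) => //; rewrite addr_ge0.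
  rewrite rmorphD scalerDl mulrDl addrACA opprD [leRHS]addrACA lerD2r.
  exact: qs.1.
- move=> _ s x [t t0 ->] s0.
  exists (fun x => q (x + iota (s * t) *: y) - (s * t) * q y).
    by exists (s * t) => //; rewrite mulr_ge0// ltW.
  by rewrite rmorphM -scalerA -scalerDr mulrBr mulrA lerD2r qs.2.
Qed.

(** Zorn's lemma for the reversed pointwise order. The pointwise infimum of a nonempty chain is
    again sublinear, and [- p (- x)] bounds the chain from below at [x]. *)
Lemma minimal_sublinear p : sublinear p ->
  exists q, [/\ sublinear q, forall x, q x <= p x &
    forall q', sublinear q' -> (forall x, q' x <= q x) -> q' = q].
Proof.
move=> ps.
pose T := {q | sublinear q /\ forall x, q x <= p x}.
pose r (f g : T) := `[< forall x, sval g x <= sval f x >].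
have [|||A Atot|[q [qs qp]] qmin] := @Zorn T r.
- by move=> f; apply/asboolP.
- move=> f g h /asboolP fg /asboolP gh; apply/asboolP => x.
  exact: le_trans (gh x) (fg x).
- move=> [f fP] [g gP] /asboolP fg /asboolP gf; apply/eq_exist/funext => x.
  by apply/le_anti; rewrite gf fg.
- have [[f0 Af0]|A0] := pselect (A !=set0); last first.
    exists (exist _ p (conj ps (fun=> lexx _))) => s As.
    by exfalso; apply: A0; exists s.
  have lb x : has_lbound [set f x | f in [set sval f | f in A]].
    exists (- p (- x)) => _ [_ [[f [fs fp]] Af <-] <-] /=.
    by apply: le_trans (sublinear_geN _ x fs); rewrite lerN2.
  have gs : sublinear (pointwise_inf [set sval f | f in A]).
    apply: sublinear_inf => //.
    - by exists (sval f0), f0.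
    - move=> _ _ x y [f Af <-] [g Ag <-].
      (* The smaller of the two members of the chain serves as [h]. *)
      have [/asboolP fg|/asboolP gf] := Atot _ _ Af Ag.
        exists (sval g); first by exists g.
        by apply: le_trans ((svalP g).1.1 _ _) _; rewrite lerD2r.
      exists (sval f); first by exists f.
      by apply: le_trans ((svalP f).1.1 _ _) _; rewrite lerD2l.
    - move=> _ t x [f Af <-] t0; exists (sval f); first by exists f.
      exact: (svalP f).1.2.
  have gle f x : A f -> pointwise_inf [set sval f | f in A] x <= sval f x.
    by move=> Af; apply: pointwise_inf_le => //; exists f.
  have gp x : pointwise_inf [set sval f | f in A] x <= p x.
    exact: le_trans (gle _ _ Af0) ((svalP f0).2 x).
  exists (exist _ (pointwise_inf _) (conj gs gp)) => s As; apply/asboolP => x /=.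
  exact: gle.
- exists q; split => // q' q's q'q.
  have q'p x : q' x <= p x by exact: le_trans (q'q x) (qp x).
  have := qmin (exist _ q' (conj q's q'p)).
  by move=> /(_ (asboolT q'q)) [].
Qed.

(** A minimal functional is taken below [flatten_along p v] rather than just below [p]: the
    flattened functional is at most [- p v] at [- v], which forces equality at [v]. *)
Lemma hahn_banach p v : sublinear p ->
  exists f : V -> R, [/\ forall x y, f (x + y) = f x + f y,
    forall t x, f (iota t *: x) = t * f x, forall x, f x <= p x & f v = p v].
Proof.
move=> ps.
have [f [fs fp fmin]] := minimal_sublinear _ (sublinear_flatten_along p v ps).
have fle x : f x <= p x.
  apply: le_trans (fp x) _; apply: le_trans (flatten_along_le _ v x 0 ps _) _ => //.
  by rewrite rmorph0 scale0r addr0 mul0r subr0.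
have fD x y : f (x + y) = f x + f y.
  apply/le_anti; rewrite fs.1/= -lerBrDr.
  (* By minimality, flattening along [y] leaves [f] unchanged, and its term with [t = 1] is
     [f (x + y) - f y]. *)
  have /(congr1 (@^~ x)) {1}<- : flatten_along f y = f.
    apply: fmin; first exact: sublinear_flatten_along.
    move=> z; apply: le_trans (flatten_along_le _ y z 0 fs _) _ => //.
    by rewrite rmorph0 scale0r addr0 mul0r subr0.
  apply: le_trans (flatten_along_le _ y x 1 fs ler01) _.
  by rewrite rmorph1 scale1r mul1r.
have fN x : f (- x) = - f x.
  by apply/eqP; rewrite -addr_eq0 -fD addNr sublinear0.
exists f; split => //.
- move=> t x; have [t0|t0] := leP 0 t; first exact: sublinearZ.
  by rewrite -[t]opprK rmorphN scaleNr fN sublinearZ ?mulNr// oppr_ge0 ltW.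
- apply/le_anti; rewrite fle/= -lerN2 -fN.
  apply: le_trans (fp _) _.
  apply: le_trans (flatten_along_le _ v (- v) 1 ps ler01) _.
  by rewrite rmorph1 scale1r addNr sublinear0// mul1r sub0r.
Qed.

End hahn_banach.

(** * Real scalars and real-valued norms over either base field *)

Definition of_real (R : realType) (b : base_field) :
    {rmorphism R -> scalar_field R b} :=
  match b with RealField => idfun | ComplexField => real_complex R end.

Section rnorm.
Context {R : realType} {b : base_field}.
Local Notation K := (scalar_field R b).
Local Notation "t %:K" := (of_real R b t) (at level 2).
Implicit Types V : normedModType K.

Lemma of_real_le (x y : R) : (x%:K <= y%:K) = (x <= y).
Proof. by rewrite /of_real; case: b => //=; rewrite lecR. Qed.

Lemma of_real_inj : injective (of_real R b).
Proof. exact: fmorph_inj. Qed.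

Lemma norm_of_real (t : R) : `|t%:K| = `|t|%:K.
Proof.
rewrite /of_real; case: b => //=.
by rewrite normc_def/= expr0n addr0 sqrtr_sqr.
Qed.

(** The norm is nonnegative, hence real, so the laws of the norm pass between the field and the
    reals through [of_real]. *)
Lemma normE V (v : V) : `|v| = (rnorm v)%:K.
Proof.
by case: b V v => //= V v; rewrite /rnorm/= RRe_real ?normr_real.
Qed.

Lemma rnorm_of_real (t : R) : rnorm (t%:K : K^o) = `|t|.
Proof. by apply: of_real_inj; rewrite -normE norm_of_real. Qed.

Lemma rnorm_ge0 V (v : V) : 0 <= rnorm v.
Proof. by rewrite -of_real_le rmorph0 -normE. Qed.

Lemma rnorm0 V : rnorm (0 : V) = 0.
Proof. by apply: of_real_inj; rewrite -normE normr0 rmorph0. Qed.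

Lemma rnorm_eq0 V (v : V) : (rnorm v == 0) = (v == 0).
Proof. by rewrite -[RHS]normr_eq0 normE fmorph_eq0. Qed.

Lemma ler_rnormD V (v w : V) : rnorm (v + w) <= rnorm v + rnorm w.
Proof. by rewrite -of_real_le rmorphD -!normE ler_normD. Qed.

Lemma rnormZ V (c : K) (v : V) : rnorm (c *: v) = rnorm (c : K^o) * rnorm v.
Proof. by apply: of_real_inj; rewrite rmorphM -!normE normrZ. Qed.

Lemma rnormZ_of_real V (t : R) (v : V) : rnorm (t%:K *: v) = `|t| * rnorm v.
Proof. by rewrite rnormZ rnorm_of_real. Qed.

Lemma sublinear_rnorm V : sublinear (of_real R b) (@rnorm R b V).
Proof.
split=> [x y|t x t0]; first exact: ler_rnormD.
by rewrite rnormZ_of_real gtr0_norm.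
Qed.

End rnorm.

(** * Norming forms over the real and the complex field *)

Lemma ler_Re_normc (R : realType) (z : R[i]) : complex.Re z <= complex.Re `|z|.
Proof.
rewrite normc_def/= (le_trans (ler_norm _))// -sqrtr_sqr ler_sqrt ?addr_ge0 ?sqr_ge0//.
by rewrite lerDl sqr_ge0.
Qed.

Lemma norming_form_real (R : realType) (Y : normedModType R) (v : Y) :
  exists f : Y -> R^o, [/\ linear f, forall y, `|f y| <= `|y| & `|v| <= `|f v|].
Proof.
have [u [uD uZ uN uv]] := hahn_banach _ _ v (@sublinear_rnorm R RealField Y).
exists u; split=> [a x y|y|].
- by rewrite uD uZ.
- have uNy : u (- y) = - u y by have := uZ (-1) y; rewrite scaleN1r mulN1r.
  by rewrite ler_norml uN andbT lerNl -uNy (le_trans (uN _))// /rnorm/= normrN.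
- by rewrite uv ler_norm.
Qed.

(* A complex form [f] with real part [u] satisfies [f x = u x - i u (i x)]. *)
Lemma norming_form_complex (R : realType) (Y : normedModType R[i]) (v : Y) :
  exists f : Y -> R[i]^o, [/\ linear f, forall y, `|f y| <= `|y| & `|v| <= `|f v|].
Proof.
have [u [uD uZ uN uv]] := hahn_banach _ _ v (@sublinear_rnorm R ComplexField Y).
rewrite /= in uZ.
pose f x : R[i]^o := (u x +i* - u ('i *: x))%C.
have ZE (a : R[i]) (x : Y) :
    a *: x = (complex.Re a)%:C%C *: x + (complex.Im a)%:C%C *: ('i%C *: x).
  by rewrite {1}[a]complexE scalerDl scalerA mulrC.
have fl : linear f.
  move=> a x y.
  have uE : u ('i%C *: (a *: x)) =
      complex.Re a * u ('i%C *: x) - complex.Im a * u x.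
    rewrite (ZE a) scalerDr !scalerA !(mulrC 'i%C) -!mulrA -expr2 sqr_i.
    by rewrite mulrN1 -rmorphN -scalerA uD !uZ mulNr.
  rewrite /f scalerDr !uD uE (ZE a) uD !uZ; case: a {uE} => a1 a2 /=.
  by rewrite /GRing.scale/=; congr (_ +i* _)%C; ring.
have ReN (y : Y) : (rnorm (y : Y : normedModType (scalar_field R ComplexField)))%:C%C = `|y|.
  by rewrite [RHS](@normE R ComplexField).
exists f; split => // [y|].
- have [->|fy0] := eqVneq (f y) 0; first by rewrite normr0.
  (* The unimodular [c] rotates [f y] onto its modulus. This modulus is real, so it equals
     [u (c *: y)], which the norm of [y] bounds. *)
  pose c := `|f y| / f y.
  have c1 : `|c| = 1 by rewrite normrM normfV normr_id divff// normr_eq0.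
  have fc : f (c *: y) = `|f y|.
    have := fl c y 0; rewrite addr0 => ->.
    have -> : f 0 = 0 by have := fl 1 0 0; rewrite !scale1r addr0 -{1}[f 0]addr0 => /addrI.
    by rewrite addr0 /GRing.scale/= divfK.
  have := uN (c *: y).
  rewrite -lecR ReN normrZ c1 mul1r; apply: le_trans.
  have -> : u (c *: y) = complex.Re (f (c *: y)) by [].
  by rewrite fc RRe_real ?normr_real.
- rewrite -ReN -uv -[leRHS]RRe_real ?normr_real// lecR.
  exact: (ler_Re_normc _ (f v)).
Qed.

(** * Monotonicity and scaling of lp norms, and the exponent for [q = +oo] *)

Section lp_norm.
Context {R : realType}.
Implicit Types (p : \bar R) (c : R).

Lemma lp_norm_ge0 p m (a : 'I_m -> R) : 0 <= lp_norm p a.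
Proof. by case: p => [r||] /=; rewrite ?powR_ge0 ?bigmax_ge_id. Qed.

Lemma ler_lp_norm p m (a a' : 'I_m -> R) : (1 <= p)%E ->
  (forall i, `|a i| <= `|a' i|) -> lp_norm p a <= lp_norm p a'.
Proof.
case: p => [r r1 aa'|_ aa'|//] /=; last exact: le_bigmax2.
have r0 : 0 <= r by rewrite (le_trans ler01)// -lee_fin.
have sum_ge0 (f : 'I_m -> R) : 0 <= \sum_i `|f i| `^ r.
  by apply: sumr_ge0 => i _; exact: powR_ge0.
apply: ge0_ler_powR; rewrite ?invr_ge0 ?nnegrE ?sum_ge0//.
by apply: ler_sum => i _; apply: ge0_ler_powR; rewrite ?nnegrE.
Qed.

Lemma lp_normZ_le p m c (a : 'I_m -> R) : (1 <= p)%E -> 0 <= c ->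
  lp_norm p (fun i => c * a i) <= c * lp_norm p a.
Proof.
case: p => [r r1 c0|_ c0|//] /=.
  have r0 : r != 0 by rewrite gt_eqF// (lt_le_trans ltr01)// -lee_fin.
  under eq_bigr do rewrite normrM powRM// (ger0_norm c0).
  rewrite -mulr_sumr powRM ?powR_ge0//; last first.
    by apply: sumr_ge0 => i _; exact: powR_ge0.
  by rewrite -powRrM divff// powRr1.
apply: bigmax_le => [|i _]; first by rewrite mulr_ge0// bigmax_ge_id.
by rewrite normrM (ger0_norm c0) ler_wpM2l// (le_bigmax _ (fun i => `|a i|)).
Qed.

(** For [q = +oo] the relation reads [1 = 1/r + 1/p], so [p] is conjugate to [r], also at the ends
    [p = 1], [r = +oo] and [p = +oo], [r = 1]. *)
Lemma hoelder_conjugate_third_exponent p : (1 <= p)%E ->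
  hoelder_conjugate (third_exponent p +oo%E) = p.
Proof.
move=> p1.
have p0 : (0 <= p)%E by exact: le_trans p1.
have ip1 : (p^-1 <= 1)%E by rewrite -inve_ge1 ?inve_ge0// inveK.
have ipfin : (p^-1)%E \is a fin_num.
  by rewrite ge0_fin_numE ?inve_ge0// (le_lt_trans ip1) ?ltry.
have s0 : (0 <= 1 - p^-1)%E by rewrite sube_ge0 ?ipfin.
have sfin : (1 - p^-1)%E \is a fin_num by rewrite fin_numB ipfin.
rewrite /third_exponent invey sube0; apply/esym/hoelder_conjugateP.
- by rewrite (lt_le_trans (ltNyr 0))// inve_ge0.
- by rewrite inve_eq0; apply: contraTneq sfin => ->.
- by rewrite inveK subeK.
Qed.

End lp_norm.

(** * Dual and bidual balls, weak norms, and the equivalence for a fixed constant *)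

Section duality.
Context {R : realType} {b : base_field}.
Local Notation K := (scalar_field R b).
Implicit Types Y : normedModType K.

Lemma norming_dual Y (v : Y) :
  exists2 f : dual Y, (dual_norm f <= 1)%E & rnorm v <= rnorm (f v).
Proof.
have [f [fl fN fv]] : exists f : Y -> K^o,
    [/\ linear f, forall y, `|f y| <= `|y| & `|v| <= `|f v|].
  case: b Y v => Y v; [exact: norming_form_real|exact: norming_form_complex].
have fB : f \in bounded_form (Y := Y).
  by apply/asboolP; split => //; exists 1 => y; rewrite mul1r.
exists (@Dual _ _ f fB); last by rewrite -(of_real_le (b := b)) -!normE.
apply: ge_ereal_sup => _ [y /= y1 <-]; rewrite lee_fin (le_trans _ y1)//.
by rewrite -(of_real_le (b := b)) -!normE.
Qed.

Lemma dual_linear Y (f : dual Y) : linear f.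
Proof. by case: f => f /= /asboolP[]. Qed.

Lemma dualZ Y (f : dual Y) (c : K) y : f (c *: y) = c *: f y.
Proof.
have f0 : f 0 = 0.
  by have := dual_linear _ f 1 0 0; rewrite !scale1r addr0 -{1}[f 0]addr0 => /addrI.
by have := dual_linear _ f c y 0; rewrite f0 !addr0.
Qed.

Lemma dual_bounded Y (f : dual Y) :
  exists2 M : R, 0 <= M & forall y, rnorm (f y) <= M * rnorm y.
Proof.
(* [M] is merely an element of the field. Its modulus still bounds, because [M] times the norm of
   [y] is nonnegative and so equals its own modulus. *)
case: f => f /= /asboolP[_ [M fM]]; exists (rnorm (M : K^o)) => [|y].
  exact: rnorm_ge0.
rewrite -(of_real_le (b := b)) rmorphM -!normE (le_trans (fM y))//.
have My : 0 <= M * `|y| by rewrite (le_trans _ (fM y)).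
by rewrite -(ger0_norm My) normrM normr_id.
Qed.

Lemma bidual_ball_eval Y (y : Y) : rnorm y <= 1 ->
  bidual_ball (fun f : dual Y => f y).
Proof.
move=> y1; split; first by move=> a f g.
apply: ge_ereal_sup => _ [f /= f1 <-]; apply: le_trans f1.
by apply: ereal_sup_ubound; exists y.
Qed.

(** The supremum of an empty set would be [-oo]; evaluation at 0 shows that the bidual ball is
    inhabited. *)
Lemma weak_norm_ge0 (q : \bar R) Y m (y : 'I_m -> dual Y) : (0 <= weak_norm q y)%E.
Proof.
have /bidual_ball_eval e0 : rnorm (0 : Y) <= 1 by rewrite rnorm0.
apply: ereal_sup_ge; eexists; first exists (fun f : dual Y => f 0) => //.
by rewrite lee_fin lp_norm_ge0.
Qed.

Lemma le_weak_normy Y m (y : 'I_m -> dual Y) i v :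
  ((rnorm (y i v))%:E <= weak_norm +oo y * (rnorm v)%:E)%E.
Proof.
(* The vector 0 cannot be normalized; there the bound holds even for an infinite weak norm, since
   [+oo * 0 = 0]. *)
have [->|v0] := eqVneq v 0.
  have -> : y i 0 = 0 by have := dualZ _ (y i) 0 0; rewrite !scale0r.
  by rewrite !rnorm0 mule0.
have nv0 : 0 < rnorm v by rewrite lt_neqAle eq_sym rnorm_eq0 v0 rnorm_ge0.
pose w := of_real R b (rnorm v)^-1 *: v.
have w1 : rnorm w = 1.
  by rewrite rnormZ_of_real ger0_norm ?mulVf ?gt_eqF// invr_ge0 ltW.
have -> : rnorm (y i v) = rnorm (y i w) * rnorm v.
  rewrite dualZ rnormZ_of_real ger0_norm ?invr_ge0 1?ltW//.
  by rewrite mulrAC mulVf ?mul1r// gt_eqF.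
rewrite EFinM lee_wpmul2r ?lee_fin ?rnorm_ge0//.
apply: ereal_sup_ge; eexists.
  by exists (fun f : dual Y => f w) => //; apply: bidual_ball_eval; rewrite w1.
rewrite lee_fin /= (le_trans (ler_norm _))//.
exact: (le_bigmax _ (fun i => `|rnorm (y i w)|)).
Qed.

Lemma weak_normy_le1 Y m (y : 'I_m -> dual Y) :
  (forall i, dual_norm (y i) <= 1)%E -> (weak_norm +oo y <= 1)%E.
Proof.
move=> y1; apply: ge_ereal_sup => _ [psi [_ psi1] <-]; rewrite lee_fin /=.
apply: bigmax_le => // i _; rewrite ger0_norm ?rnorm_ge0// -lee_fin.
by apply: le_trans psi1; apply: ereal_sup_ubound; exists (y i) => //; exact: y1.
Qed.

Lemma weak_pi_norm_ge0 p n (X : 'I_n -> normedModType K) m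
  (x z : 'I_m -> forall j, X j) : (0 <= weak_pi_norm p x z)%E.
Proof.
have form0 : forms_ball (fun _ : forall j, X j => 0).
  split; first split.
  - by move=> j y a u v; rewrite scaler0 addr0.
  - by exists 0 => y; rewrite rnorm0 mul0r.
  - by apply: ge_ereal_sup => _ [y _ <-]; rewrite rnorm0 lee_fin.
apply: ereal_sup_ge; eexists; first by exists (fun=> 0).
by rewrite lee_fin lp_norm_ge0.
Qed.

Lemma pi_dominated_with_inftyP n (X : 'I_n -> normedModType K) Y
    (p : \bar R) (T : (forall j, X j) -> Y) (C : R) : (1 <= p)%E -> 0 < C ->
  pi_dominated_with p +oo T C <-> lip_summing_with p T C.
Proof.
move=> p1 C0; have pC := hoelder_conjugate_third_exponent _ p1.
have CW_ge0 m (x z : 'I_m -> forall j, X j) : (0 <= C%:E * weak_pi_norm p x z)%E.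
  by rewrite mule_ge0 ?lee_fin ?(ltW C0)// weak_pi_norm_ge0.
split=> [TC m x z|TC m x z y].
- have /choice[y yP] : forall i, exists f : dual Y, (dual_norm f <= 1)%E /\
      rnorm (T (x i) - T (z i)) <= rnorm (f (T (x i) - T (z i))).
    by move=> i; have [f] := norming_dual _ (T (x i) - T (z i)); exists f.
  have := TC m x z y; rewrite pC => {}TC.
  apply: (@le_trans _ _ (C%:E * weak_pi_norm p x z * weak_norm +oo y)%E).
    apply: le_trans TC; rewrite lee_fin; apply: ler_lp_norm => // i.
    by rewrite !ger0_norm ?rnorm_ge0//; exact: (yP i).2.
  rewrite -[leRHS]mule1 lee_wpmul2l//; apply: weak_normy_le1 => i.
  exact: (yP i).1.
rewrite pC; have {}TC := TC m x z.
pose d i := T (x i) - T (z i).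
(* Used twice: with [c] the weak norm of the functionals when it is finite, and otherwise with a
   crude bound on all [y i]. *)
have step c : 0 <= c -> (forall i, rnorm (y i (d i)) <= c * rnorm (d i)) ->
    lp_norm p (fun i => rnorm (y i (d i))) <= c * lp_norm p (fun i => rnorm (d i)).
  move=> c0 yc; apply: le_trans (lp_normZ_le _ _ _ _ p1 c0); apply: ler_lp_norm => // i.
  by rewrite !ger0_norm ?mulr_ge0 ?rnorm_ge0.
have := weak_norm_ge0 +oo _ _ y; have := le_weak_normy _ _ y.
case: (weak_norm +oo y) => [w|_ _|//].
  rewrite lee_fin => yw w0.
  apply: (@le_trans _ _ (lp_norm p (fun i => rnorm (d i)) * w)%:E).
    by rewrite lee_fin mulrC; apply: step => // i; rewrite -lee_fin EFinM.
  by rewrite EFinM lee_wpmul2r.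
(* The finiteness of the weak norm is bypassed; as [0 * +oo = 0], only the case
   of a vanishing [C%:E * weak_pi_norm p x z] needs an argument. *)
have := CW_ge0 m x z; rewrite le_eqVlt => /predU1P[CW|CW]; last first.
  by rewrite gt0_muley ?leey.
rewrite -CW mul0e lee_fin.
have /choice[M MP] : forall i, exists M : R, 0 <= M /\
    forall v, rnorm (y i v) <= M * rnorm v.
  by move=> i; have [M] := dual_bounded _ (y i); exists M.
have M0 : 0 <= \sum_i M i by apply: sumr_ge0 => i _; exact: (MP i).1.
(* Any finite common bound will do, as the lp norm of the [d i] is at most 0; the sum of the
   nonnegative [M i] dominates each of them. *)
apply: (le_trans (step (\sum_i M i) M0 _)) => [i|].
  apply: le_trans ((MP i).2 _) _; rewrite ler_wpM2r ?rnorm_ge0//.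
  rewrite (bigD1 i)//= lerDl; apply: sumr_ge0 => j _; exact: (MP j).1.
by rewrite mulr_ge0_le0// -lee_fin [leRHS]CW.
Qed.

End duality.

Theorem corollary3p4 (R : realType) (b : base_field) (n : nat) (n_gt0 : (0 < n)%N)
    (X : 'I_n -> completeNormedModType (scalar_field R b))
    (Y : completeNormedModType (scalar_field R b))
    (p : \bar R) (p_ge1 : (1 <= p)%E)
    (T : (forall j, X j) -> Y) (T_mult : bounded_multilinear T) :
  (pi_dominated p +oo%E T <-> lip_summing p T) /\
  (lip_summing p T -> lip_summing_norm p T = pi_dominated_norm p +oo%E T).
Proof.
(* Both notions admit the same constants, so both infima are taken over the same set. *)
have eqv C : 0 < C -> pi_dominated_with p +oo%E T C <-> lip_summing_with p T C.
  exact: pi_dominated_with_inftyP.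
split; first by split=> -[C C0 TC]; exists C => //; apply/eqv.
move=> _; congr inf; apply/seteqP.
by split=> C [C0 TC]; split=> //; apply/eqv.
Qed.
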